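(* Let $\mathbf P=(P,\leq)$ be a partially ordered set with maximum $1$. (1) If the Frattini element $\Phi$ of $\mathbf P$ exists and is locally $1$-compact, or just very-weakly-locally-$1$-compact, then $\Phi$ is the join of all the non-generators of $\mathbf P$. (2) In particular, if $\mathbf P$ is a complete $1$-algebraic lattice, or just a complete very-weakly-$1$-algebraic lattice, then $\Phi$ is the join of all the non-generators of $\mathbf P$. (3) If $\mathbf P$ is a very-weakly-$1$-algebraic poset, then $\Phi$ exists if and only if the join of all the non-generators exists and, if this is the case, they coincide. (4) If $\mathbf P$ is a finite join-semilattice and there exists at least one non-generator, then $\Phi$ exists and is the join of all the non-generators.
   Context: Let $\mathbf P=(P,\leq)$ be a poset with maximum $1$ (not assumed to be a semilattice unless stated). For $a,e \in P$, ''$a \vee e = 1$'' means that there is no $p \in P$ such that $p<1$, $a \leq p$ and $e \leq p$. For $X\subseteq P$, ''$\bigvee X=1$'' means that there is no $p\in P$ such that $p<1$ and $x\leq p$ for every $x\in X$. Otherwise, join and meet mean least upper bound and greatest lower bound in $\mathbf P$, when they exist. An element $a\in P$ is a non-generator if, for every $e \in P$, $a\vee e=1$ implies $e=1$. An element $p\in P$ is maximal$_{<1}$ if $p<1$ and there is no $q \in P$ such that $p<q<1$. An element $e\in P$ can be extended to a maximal$_{<1}$ element if there is a maximal$_{<1}$ element $p$ with $e \leq p$. If the meet of all the maximal$_{<1}$ elements of $\mathbf P$ exists, it is denoted by $\Phi$ and called the Frattini element of $\mathbf P$. If $\mathbf P$ has no maximal$_{<1}$ element, we set $\Phi=1$.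 A chain is a nonempty subset that is linearly ordered by the induced order; chains are denoted as families $(e_i)_{i\in I}$. An element $a$ is $1$-compact if, whenever $(e_i)_{i\in I}$ is a chain of elements of $P$ and $\bigvee_{i\in I}e_i=1$, then $a\leq e_i$ for some $i \in I$. An element $a$ is very-weakly-$1$-compact if, whenever $(e_i)_{i\in I}$ is a chain of elements of $P$ with $e_i<1$ for every $i\in I$, $\bigvee_{i\in I}e_i=1$, and no $e_i$ can be extended to a maximal$_{<1}$ element, then there are some $i\in I$ and some $r\in P$ such that $r<1$, $e_i\leq r$ and $a\leq r$. An element $b$ of $\mathbf P$ is locally $1$-compact (respectively, very-weakly-locally-$1$-compact) if $b$ can be expressed as the join of a family of $1$-compact (respectively, very-weakly-$1$-compact) elements. The poset $\mathbf P$ is $1$-algebraic (respectively, very-weakly-$1$-algebraic) if every element of $P$ is locally $1$-compact (respectively, very-weakly-locally-$1$-compact). *)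

(* Defs.v *)
From HB Require Import structures.
From mathcomp Require Import all_boot all_order.
From mathcomp Require Import boolp classical_sets functions cardinality.
Set Implicit Arguments.
Unset Strict Implicit.
Unset Printing Implicit Defensive.
Import Order.TTheory.
Local Open Scope classical_set_scope.
Local Open Scope order_scope.

(* Least upper bounds and greatest lower bounds, which need not exist, are the
   members of [supremums X] and [infimums X] from [classical_sets]. *)

Section OneCompactness.
Context {d : Order.disp_t} {P : tPOrderType d}.
Implicit Types (a b e m phi : P) (C X : set P).

(* "a \/ e = 1" *)
Definition join2_top a e : Prop :=
  ~ (exists p : P, [/\ p < \top, a <= p & e <= p]).

(* "\/ X = 1" *)
Definition join_top X : Prop :=
  ~ (exists p : P, p < \top /\ (forall x, X x -> x <= p)).

Definition non_generator a : Prop := forall e, join2_top a e -> e = \top.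

Definition maximal_lt1 m : Prop :=
  m < \top /\ ~ (exists q : P, m < q /\ q < \top).

Definition extends_to_maximal e : Prop :=
  exists m, maximal_lt1 m /\ e <= m.

Definition is_frattini phi : Prop :=
  ((exists m, maximal_lt1 m) /\ infimums [set m | maximal_lt1 m] phi) \/
  (~ (exists m, maximal_lt1 m) /\ phi = \top).

Definition is_chain C : Prop :=
  C !=set0 /\ total_on C (fun x y => x <= y).

Definition one_compact a : Prop :=
  forall C, is_chain C -> join_top C -> exists2 e, C e & a <= e.

Definition very_weakly_one_compact a : Prop :=
  forall C, is_chain C -> (forall e, C e -> e < \top) -> join_top C ->
    (forall e, C e -> ~ extends_to_maximal e) ->
    exists e r, [/\ C e, r < \top, e <= r & a <= r].

Definition locally_one_compact b : Prop :=
  exists X, (forall x, X x -> one_compact x) /\ supremums X b.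

Definition very_weakly_locally_one_compact b : Prop :=
  exists X, (forall x, X x -> very_weakly_one_compact x) /\ supremums X b.

Definition join_of_non_generators b : Prop :=
  supremums [set a | non_generator a] b.

End OneCompactness.

Section PosetProperties.
Context {d : Order.disp_t} (P : tPOrderType d).

Definition one_algebraic : Prop := forall b : P, locally_one_compact b.

Definition very_weakly_one_algebraic : Prop :=
  forall b : P, very_weakly_locally_one_compact b.

Definition complete_lattice : Prop :=
  forall X : set P, (exists s, supremums X s) /\ (exists i, infimums X i).

Definition join_semilattice : Prop :=
  forall a b : P, exists s, supremums [set a; b] s.

End PosetProperties.

(* Main.v *)
Require Import Defs.
From mathcomp Require Import all_boot all_order.
From mathcomp Require Import boolp classical_sets functions cardinality.
Import Order.TTheory.
Local Open Scope classical_set_scope.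
Local Open Scope order_scope.

(** A non-generator lies below every maximal element [m < 1], as its join with
    [m] is not [1]. Conversely, let [a] be very-weakly-1-compact and below all
    the maximal elements, and let [e < 1]. If [e] extends to a maximal element,
    that element bounds [e] and [a]. Otherwise Zorn's lemma fails above [e], and
    a chain without upper bound [< 1] witnessing this failure is one to which
    very-weak-1-compactness of [a] applies. Hence, among very-weakly-1-compact
    elements, non-generators are the lower bounds of the maximal elements. *)

Section NonGenerators.
Context {d : Order.disp_t} {P : tPOrderType d}.
Implicit Types (a b e m p phi j : P) (C S : set P).

Lemma join2_topPn a e :
  ~ join2_top a e <-> exists p, [/\ p < \top, a <= p & e <= p].
Proof. by split=> [/contrapT|ex /(_ ex)]. Qed.

(* The convention [Phi = 1] is the case of an empty infimum. *)
Lemma is_frattiniE phi :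
  is_frattini phi <-> infimums [set m | maximal_lt1 m] phi.
Proof.
split=> [[[_ //]|[noM ->]]|infphi].
  by split=> [m Mm|x _]; [case: noM; exists m | exact: lex1].
have [exM|noM] := pselect (exists m, maximal_lt1 m); first by left.
right; split=> //; apply: le_anti; rewrite lex1 /=.
by apply: infphi.2 => m Mm; case: noM; exists m.
Qed.

Lemma non_generator_le_maximal a m :
  non_generator a -> maximal_lt1 m -> a <= m.
Proof.
move=> ng [m1 mmax].
have /join2_topPn[p [p1 ap mp]] : ~ join2_top a m.
  by move=> /ng m1'; rewrite m1' ltxx in m1.
move: mp; rewrite le_eqVlt => /orP[/eqP -> //|mp].
by case: mmax; exists p.
Qed.

Lemma non_generator_lbound :
  [set a : P | non_generator a] `<=` lbound [set m | maximal_lt1 m].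
Proof. by move=> a ng m; exact: non_generator_le_maximal. Qed.

Lemma chain_above_inextensible e : e < \top -> ~ extends_to_maximal e ->
  exists C, [/\ is_chain C, join_top C & forall c, C c -> e <= c < \top].
Proof.
move=> e1 nex; apply: contrapT => noC.
(* Zorn is applied to the interval from [e] up to, but excluding, [\top]. *)
pose T := {q : P | e <= q < \top}.
have eT : e <= e < \top by rewrite lexx.
have [|||A Atot|t tmax] := @Zorn T (fun s t => sval s <= sval t).
- by move=> t /=.
- by move=> r s t /=; exact: le_trans.
- by move=> s t st ts; apply/val_inj/le_anti; rewrite st.
(* A chain must be nonempty, so the empty family is treated apart, with [e] as its bound. Otherwise
   any [p < \top] bounding the image of [A] lies above some member, hence above [e], and so belongs
   to [T]. *)
- have [[s As]|A0] := pselect (A !=set0); last first.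
    by exists (exist _ e eT) => s As; case: A0; exists s.
  apply: contrapT => noub; apply: noC; exists [set sval t | t in A]; split.
  + split; first by exists (sval s), s.
    by move=> _ _ [r Ar <-] [t At <-]; exact: Atot.
  + move=> [p [p1 Ap]].
    have pT : e <= p < \top.
      have /andP[es _] := proj2_sig s.
      by rewrite p1 andbT (le_trans es)// Ap//; exists s.
    by apply: noub; exists (exist _ p pT) => r Ar; apply: Ap; exists r.
  + by move=> _ [t _ <-]; exact: proj2_sig t.
(* Anything strictly between [t] and [\top] is also above [e], so maximality in [T] gives maximality
   below [\top] in [P]. *)
- have /andP[et t1] := proj2_sig t; apply: nex; exists (sval t); split=> //.
  split=> // -[q [tq q1]].
  have qT : e <= q < \top by rewrite q1 andbT (le_trans et)// ltW.
  have qt := tmax (exist _ q qT) (ltW tq).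
  by move: tq; rewrite -qt /= ltxx.
Qed.

Lemma lbound_maximal_non_generator a : very_weakly_one_compact a ->
  lbound [set m | maximal_lt1 m] a -> non_generator a.
Proof.
move=> ca aM e ae; apply/eqP/negP => /negP; rewrite -ltx1 => e1; apply: ae.
have [[m [Mm em]]|nex] := pselect (extends_to_maximal e).
  by exists m; split=> //; [case: Mm | exact: aM].
have [C [Cchain C1 eC]] := chain_above_inextensible e e1 nex.
(* Inextensibility passes from [e] to every element above it, hence to all of [C]. *)
have [|c Cc [m [Mm cm]]|c [r [Cc r1 cr ar]]] := ca C Cchain _ C1.
- by move=> c /eC /andP[].
- by apply: nex; exists m; split=> //; apply: le_trans cm; case/andP: (eC c Cc).
- by exists r; split=> //; apply: le_trans cr; case/andP: (eC c Cc).
Qed.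

Lemma one_compact_very_weakly a : one_compact a -> very_weakly_one_compact a.
Proof.
move=> ca C Cchain C_lt1 C1 _; have [e Ce ae] := ca C Cchain C1.
by exists e, e; split=> //; exact: C_lt1.
Qed.

Lemma locally_one_compact_very_weakly b :
  locally_one_compact b -> very_weakly_locally_one_compact b.
Proof.
move=> [X [cX supX]]; exists X; split=> // x /cX.
exact: one_compact_very_weakly.
Qed.

(** The very-weakly-1-compact elements that join to [b] lie below [b], hence below all maximal
    elements, so they are non-generators and [u] bounds them. *)
Lemma le_ubound_non_generators b u : very_weakly_locally_one_compact b ->
  lbound [set m | maximal_lt1 m] b -> ubound [set a | non_generator a] u ->
  b <= u.
Proof.
move=> [X [cX [ubX leX]]] bM uN; apply: leX => x Xx; apply: uN.
apply: lbound_maximal_non_generator; first exact: cX.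
by move=> m Mm; apply: le_trans (bM m Mm); exact: ubX.
Qed.

Lemma frattini_join_of_non_generators phi :
  is_frattini phi -> very_weakly_locally_one_compact phi ->
  join_of_non_generators phi.
Proof.
move=> /is_frattiniE[phiM gephi] cphi; split.
  by move=> a /non_generator_lbound; exact: gephi.
by move=> u uN; exact: le_ubound_non_generators uN.
Qed.

Lemma frattini_non_generatorsP phi : very_weakly_one_algebraic P ->
  is_frattini phi <-> join_of_non_generators phi.
Proof.
move=> algP; split=> [Fphi|[phiN lephi]].
  exact: frattini_join_of_non_generators.
(* Each maximal [m] is an upper bound of the non-generators, hence above their join [phi].
   Algebraicity is applied to an arbitrary lower bound [b], not just to [phi]. *)
apply/is_frattiniE; split=> [m Mm|b bM].
  by apply: lephi => a; move=> /non_generator_lbound; exact.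
exact: le_ubound_non_generators bM _.
Qed.

Lemma complete_lattice_frattini :
  complete_lattice P -> exists phi : P, is_frattini phi.
Proof.
move=> cP; have [_ [phi infphi]] := cP [set m | maximal_lt1 m].
by exists phi; apply/is_frattiniE.
Qed.

Lemma finite_directed_max S : finite_set S -> S !=set0 ->
  (forall a b, S a -> S b -> exists c, [/\ S c, a <= c & b <= c]) ->
  exists2 c, S c & ubound S c.
Proof.
move=> /finite_seqP[s Ss] [x Sx] dirS.
suff [c Sc sc] : exists2 c, S c & forall y, y \in s -> y <= c.
  by exists c => // y; rewrite Ss; exact: sc.
(* Weakening the enumeration of [S] to an inclusion makes induction on [s] possible; [x] serves for
   the empty list. *)
have : {subset s <= S} by move=> y ys; apply/mem_set; rewrite Ss.
elim: s {Ss} => [_|y s IHs sS]; first by exists x.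
have [z zs|c Sc sc] := IHs; first by apply: sS; rewrite inE zs orbT.
have /set_mem Sy : y \in S by apply: sS; rewrite inE eqxx.
have [b [Sb yb cb]] := dirS y c Sy Sc; exists b => // z.
by rewrite inE => /predU1P[-> //|/sc zc]; exact: le_trans cb.
Qed.

(** A finite chain has a greatest element, so a chain of elements below [\top] never has join
    [\top]. Every element is thus vacuously very-weakly-1-compact, and [b] is the join of its
    singleton. *)
Lemma finite_very_weakly_one_algebraic :
  finite_set [set: P] -> very_weakly_one_algebraic P.
Proof.
move=> finP b; exists [set b]; split; last by rewrite supremums1.
move=> x _ C [C0 Ctot] C_lt1 C1 _; case: C1.
have [||c Cc ubc] := finite_directed_max C _ C0.
- exact: sub_finite_set finP.
- move=> y z Cy Cz; have [yz|zy] := Ctot y z Cy Cz; first by exists z.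
  by exists y.
- by exists c; split; first exact: C_lt1.
Qed.

(** The elements below every upper bound of [S] include [S] and are closed under binary joins, so
    this finite set is directed; its greatest element is the join of [S]. *)
Lemma finite_join_semilattice_sup S : finite_set [set: P] ->
  join_semilattice P -> S !=set0 -> exists j, supremums S j.
Proof.
move=> finP joinP [x Sx].
have [|||j ltj jub] := finite_directed_max (lbound (ubound S)).
- exact: sub_finite_set finP.
- by exists x => u; exact.
- move=> a b aS bS; have [c [abc lec]] := joinP a b; exists c; split.
  + by move=> u uS; apply: lec => y [->|->]; [exact: aS | exact: bS].
  + by apply: abc; left.
  + by apply: abc; right.
by exists j; split=> // y Sy; apply: jub => u; exact.
Qed.

End NonGenerators.

Theorem corollary2p6 (d : Order.disp_t) (P : tPOrderType d) :
  [/\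
      forall phi : P, is_frattini phi ->
        locally_one_compact phi \/ very_weakly_locally_one_compact phi ->
        join_of_non_generators phi,
      complete_lattice P ->
        one_algebraic P \/ very_weakly_one_algebraic P ->
        exists phi : P, is_frattini phi /\ join_of_non_generators phi,
      very_weakly_one_algebraic P ->
        ((exists phi : P, is_frattini phi) <->
         (exists j : P, join_of_non_generators j)) /\
        (forall phi j : P,
           is_frattini phi -> join_of_non_generators j -> phi = j)
    &
      finite_set [set: P] -> join_semilattice P ->
        (exists a : P, non_generator a) ->
        exists phi : P, is_frattini phi /\ join_of_non_generators phi].
Proof.
split.
- move=> phi Fphi cphi; apply: frattini_join_of_non_generators => //.
  by case: cphi => // /locally_one_compact_very_weakly.
- move=> cP algP; have [phi Fphi] := complete_lattice_frattini cP.
  exists phi; split=> //; apply: frattini_join_of_non_generators => //.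
  by case: algP => // /(_ phi) /locally_one_compact_very_weakly.
- move=> algP; split.
    by split=> -[x Hx]; exists x; apply/frattini_non_generatorsP.
  move=> phi j /(frattini_non_generatorsP _ algP) Jphi Jj.
  exact: is_subset1_supremums Jphi Jj.
- move=> finP joinP [a ng].
  have algP := finite_very_weakly_one_algebraic finP.
  (* A finite join-semilattice may lack a least element, so the empty set may have no join; the
     given non-generator [a] rules this case out. *)
  have [|j Jj] :=
    finite_join_semilattice_sup [set a | non_generator a] finP joinP.
    by exists a.
  by exists j; split=> //; apply/frattini_non_generatorsP.
Qed.
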